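(* Let $(\mathcal H_n)_{n\in\overline{\mathbb N}}$ be Hilbert spaces. If $J_n:\mathcal H_n\to\mathcal H_\infty$ are contractions ($\|J_n\|\le1$) for all $n\in\mathbb N$, then there are a Hilbert space $\mathcal H$ (a parent space) and isometries $\iota_n:\mathcal H_n\to\mathcal H$, $n\in\overline{\mathbb N}$, factorising the identification operators $(J_n)_{n\in\mathbb N}$, i.e. $J_n=\iota_\infty^*\iota_n$ for all $n\in\mathbb N$.
   Context: All Hilbert spaces are complex and separable; $\mathbb N=\{1,2,\dots\}$, $\overline{\mathbb N}=\mathbb N\cup\{\infty\}$. Contractions are bounded linear operators of operator norm at most $1$. *)

(* Defs.v *)
From HB Require Import structures.
From mathcomp Require Import all_boot all_order all_algebra.
From mathcomp Require Import all_classical all_reals all_analysis.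
From mathcomp Require Import complex.

Set Implicit Arguments.
Unset Strict Implicit.
Unset Printing Implicit Defensive.

Import Order.TTheory GRing.Theory Num.Theory.
Import numFieldNormedType.Exports.

Local Open Scope classical_set_scope.
Local Open Scope ring_scope.
Local Open Scope complex_scope.

(* The inner product is linear in the first argument and conjugate-linear in
   the second one. *)
HB.mixin Record CompleteNormedModule_isHilbert (R : realType) H
    of CompleteNormedModule R[i] H := {
  inner : {dot H for @Num.conj R[i]} ;
  inner_normE : forall x : H, inner x x = `|x| ^+ 2
}.

#[short(type="hilbertType")]
HB.structure Definition Hilbert (R : realType) :=
  {H of CompleteNormedModule R[i] H & CompleteNormedModule_isHilbert R H}.

Definition separable (T : topologicalType) :=
  exists2 A : set T, countable A & dense A.

Section Operators.
Variables (R : realType) (H K : hilbertType R).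

(* The norm takes its values in R[i], hence the real part; the norm is +oo when
   the operator is unbounded. *)
Definition opnorm (A : {linear H -> K}) : \bar R :=
  ereal_sup [set (complex.Re `|A x|)%:E | x in [set x : H | `|x| <= 1]].

Definition contractive_op (A : {linear H -> K}) := (opnorm A <= 1%:E)%E.

Definition is_isometry (A : {linear H -> K}) := forall x, `|A x| = `|x|.

(* At most one B satisfies this, by adjoint_unique below. *)
Definition is_adjoint (A : {linear H -> K}) (B : {linear K -> H}) :=
  forall x y, inner (A x) y = inner x (B y).

Lemma adjoint_unique A B1 B2 : is_adjoint A B1 -> is_adjoint A B2 -> B1 =1 B2.
Proof.
move=> AB1 AB2 y; apply/eqP; rewrite -subr_eq0 -normr_eq0.
rewrite -sqrf_eq0 -inner_normE linearB/= -AB1 -AB2 subrr//.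
Qed.

Lemma contractive_opP (A : {linear H -> K}) :
  contractive_op A <-> forall x, `|A x| <= `|x|.
Proof.
split=> [cA x|A1]; last first.
  apply: ge_ereal_sup => _ /= [x x1 <-]; rewrite lee_fin.
  have := le_trans (A1 x) x1.
  by rewrite lecE => /andP[].
have [->|x0] := eqVneq x 0; first by rewrite raddf0 !normr0.
have nx0 : 0 < `|x| by rewrite normr_gt0.
pose y := `|x|^-1 *: x.
have y1 : `|y| <= 1 by rewrite normrZ normfV normr_id mulVf ?gt_eqF.
have : `|A y| <= 1.
  have : ((complex.Re `|A y|)%:E <= 1%:E)%E.
    by apply: le_trans cA; apply: ereal_sup_ubound; exists y.
  rewrite lee_fin lecE.
  by have := normr_ge0 (A y); rewrite lecE => /andP[/eqP-> _] ->; rewrite eqxx.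
by rewrite linearZ normrZ normfV normr_id mulrC ler_pdivrMr// mul1r.
Qed.

End Operators.

(* Main.v *)
(* Take H = H_oo (+) l^2 with iota_oo x = (x, 0), whose adjoint is the first
   projection. It then suffices to find linear maps D_n : H_n -> l^2 with
   |D_n x|^2 = |x|^2 - |J_n x|^2, and to set iota_n x = (J_n x, D_n x); the
   ranges of the D_n need not be orthogonal to each other. Instead of the square
   root of 1 - J_n^* J_n, D_n is given by the Cholesky coefficients of the
   semi-inner product q(x, y) = <x, y> - <J_n x, J_n y> along a dense sequence a:
   subtracting from q the rank-one form of the functional
   q(., a_k) / sqrt q(a_k, a_k) keeps it positive by Cauchy-Schwarz and kills
   a_k, so the residual forms tend to 0 pointwise by density. *)
Require Import Defs.
From HB Require Import structures.
From mathcomp Require Import all_boot all_order all_algebra.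
From mathcomp Require Import all_classical all_reals all_analysis.
From mathcomp Require Import complex.
From mathcomp Require Import ring zify.

Set Implicit Arguments.
Unset Strict Implicit.
Unset Printing Implicit Defensive.

Import Order.TTheory GRing.Theory Num.Theory.
Import numFieldNormedType.Exports.

Local Open Scope classical_set_scope.
Local Open Scope ring_scope.

(** * Semi-inner products and Cholesky deflation *)

Section SemiInner.
Variables (C : numClosedFieldType) (V : lmodType C).

Record semi_inner (q : V -> V -> C) : Prop := SemiInner {
  si_linear : forall z, scalar (q^~ z);
  si_herm : forall x y, q x y = (q y x)^*;
  si_ge0 : forall x, 0 <= q x x }.

Variable q : V -> V -> C.
Hypothesis qP : semi_inner q.

Lemma si_linearr z a x y : q z (a *: x + y) = a^* * q z x + q z y.
Proof.
by rewrite (si_herm qP) (si_linear qP) rmorphD rmorphM /= -!(si_herm qP).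
Qed.

Lemma si0l z : q 0 z = 0.
Proof.
by have := si_linear qP z (-1) 0 0; rewrite scaler0 addr0 mulN1r addNr.
Qed.

Lemma siDl x y z : q (x + y) z = q x z + q y z.
Proof. by have := si_linear qP z 1 x y; rewrite scale1r mul1r. Qed.

Lemma siZl a x z : q (a *: x) z = a * q x z.
Proof. by have := si_linear qP z a x 0; rewrite si0l !addr0. Qed.

Lemma siDr x y z : q z (x + y) = q z x + q z y.
Proof. by have := si_linearr z 1 x y; rewrite scale1r rmorph1 mul1r. Qed.

Lemma siZr a x z : q z (a *: x) = a^* * q z x.
Proof. by rewrite (si_herm qP) siZl rmorphM /= -(si_herm qP). Qed.

Lemma siZZ a x : q (a *: x) (a *: x) = `|a| ^+ 2 * q x x.
Proof. by rewrite siZl siZr normCK mulrA. Qed.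

Lemma si_conj x : (q x x)^* = q x x.
Proof. by rewrite -(si_herm qP). Qed.

Lemma si_parallelogram x y :
  q (x + y) (x + y) + q (x - y) (x - y) = 2 * (q x x + q y y).
Proof.
rewrite -scaleN1r !(siDl, siDr, siZl, siZr) rmorphN rmorph1; ring.
Qed.

Lemma si_normD_le x y : q (x + y) (x + y) <= 2 * (q x x + q y y).
Proof. by rewrite -si_parallelogram lerDl si_ge0. Qed.

Lemma si_normN x : q (- x) (- x) = q x x.
Proof. by rewrite -scaleN1r siZZ normrN1 expr1n mul1r. Qed.

Lemma si_normBC x y : q (x - y) (x - y) = q (y - x) (y - x).
Proof. by rewrite -opprB si_normN. Qed.

Lemma si_normDZ a x y : q (x + a *: y) (x + a *: y) =
  q x x + a^* * q x y + a * q y x + `|a| ^+ 2 * q y y.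
Proof. rewrite !(siDl, siDr) !(siZl, siZr) normCK; ring. Qed.

(** It recovers every value of the form from diagonal ones, so that monotone convergence on the
    diagonal will give convergence off it. *)
Lemma si_polarization x y :
  4 * q x y = q (x + y) (x + y) - q (x - y) (x - y)
              + 'i * (q (x + 'i *: y) (x + 'i *: y)
                      - q (x - 'i *: y) (x - 'i *: y)).
Proof.
have i2 : 'i * 'i = -1 :> C by rewrite -expr2 sqrCi.
have := si_normDZ 1 x y; rewrite scale1r => ->.
have := si_normDZ (-1) x y; rewrite scaleN1r => ->.
have := si_normDZ (- 'i) x y; rewrite scaleNr => ->.
rewrite si_normDZ.
rewrite !rmorphN /= rmorph1 conjCi opprK !normrN.
(* The imaginary unit becomes a variable for [ring], and its square is replaced by -1 only in the
   intermediate expression below. *)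
move: (@Num.imaginary C) i2 (q x x) (q x y) (q y x) (q y y) => i i2 a b c d.
transitivity (2 * b + 2 * c - i * i * 2 * b + i * i * 2 * c).
  by rewrite i2; ring.
ring.
Qed.

(** The form may be degenerate, so the usual division by [q y y] is preceded by the case of a null
    vector [y], which must then be orthogonal to everything. *)
Lemma si_CauchySchwarz x y : `|q x y| ^+ 2 <= q x x * q y y.
Proof.
have [y0|y0] := eqVneq (q y y) 0.
  rewrite y0 mulr0; have [->|xy0] := eqVneq (q x y) 0.
    by rewrite normr0 expr0n.
  (* q is affine, hence unbounded below, along x - t q(x,y) y *)
  have := si_ge0 qP (x - ((q x x + 1) / (2 * `|q x y| ^+ 2) * q x y) *: y).
  set t := _ / _.
  have t_real : t^* = t.
    rewrite geC0_conj// divr_ge0 ?mulr_ge0 ?exprn_ge0// addr_ge0 ?si_ge0//.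
  rewrite -scaleNr !(siDl, siDr, siZl, siZr) y0 rmorphN rmorphM /= t_real.
  rewrite -(si_herm qP y x) [q y x](si_herm qP).
  have -> : q x x + - (t * (q x y)^*) * q x y +
     (- (t * q x y) * (q x y)^* + - (t * q x y) * (- (t * (q x y)^*) * 0)) =
     q x x - 2 * (t * `|q x y| ^+ 2) by rewrite normCK; ring.
  have -> : 2 * (t * `|q x y| ^+ 2) = q x x + 1.
    rewrite /t; field; rewrite ?normr_eq0//.
  by rewrite opprD addNKr oppr_ge0 ler10.
have yp : 0 < q y y by rewrite lt_def y0 si_ge0.
have := si_ge0 qP (x - (q x y / q y y) *: y).
rewrite -scaleNr !(siDl, siDr, siZl, siZr) rmorphN rmorphM fmorphV /= si_conj.
rewrite -(si_herm qP y x).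
set e := (X in 0 <= X); have -> : e = q x x - `|q x y| ^+ 2 / q y y.
  by rewrite /e normCK -(si_herm qP y x); field.
by rewrite subr_ge0 ler_pdivrMr.
Qed.

Lemma si_triangle x y :
  sqrtC (q (x + y) (x + y)) <= sqrtC (q x x) + sqrtC (q y y).
Proof.
rewrite -(@ler_pXn2r _ 2) ?nnegrE ?addr_ge0 ?sqrtC_ge0 ?si_ge0//.
rewrite sqrrD !sqrtCK siDl !siDr.
have -> : q x x + q x y + (q y x + q y y) = q x x + (q x y + q y x) + q y y.
  by ring.
rewrite lerD2r lerD2l.
have qr : q x y + q y x \is Num.real.
  by rewrite CrealE rmorphD /= -!(si_herm qP) addrC.
apply: le_trans (real_ler_norm qr) _.
apply: le_trans (ler_normD _ _) _.
rewrite [q y x](si_herm qP) norm_conjC -mulr2n ler_pMn2r//.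
rewrite -(@ler_pXn2r _ 2) ?nnegrE ?mulr_ge0 ?sqrtC_ge0 ?si_ge0//.
by rewrite exprMn !sqrtCK si_CauchySchwarz.
Qed.

End SemiInner.

(** * Cholesky deflation of a semi-inner product along a sequence *)

Section Cholesky.
Variables (C : numClosedFieldType) (V : lmodType C).

(* When [q a a = 0] the division by zero yields the zero functional. *)
Definition pivot (q : V -> V -> C) (a x : V) := q x a / sqrtC (q a a).

Definition deflate q (a x y : V) := q x y - pivot q a x * (pivot q a y)^*.

(** The Schur complement left after eliminating the [k] vectors [a 0], ..., [a k.-1]. *)
Fixpoint residual q (a : nat -> V) k :=
  if k is k'.+1 then deflate (residual q a k') (a k') else q.

Definition cholesky q a k := pivot (residual q a k) (a k).

Section Deflation.
Variables (q : V -> V -> C) (a : V).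
Hypothesis qP : semi_inner q.

Lemma pivot_linear : scalar (pivot q a).
Proof. by move=> t x y; rewrite /pivot (si_linear qP) mulrDl mulrA. Qed.

Lemma pivot_normM x : `|pivot q a x| ^+ 2 = `|q x a| ^+ 2 / q a a.
Proof.
rewrite /pivot normf_div expr_div_n.
by rewrite [`|sqrtC _|]ger0_norm ?sqrtC_ge0 ?si_ge0// sqrtCK.
Qed.

Lemma deflate_diag x : deflate q a x x = q x x - `|pivot q a x| ^+ 2.
Proof. by rewrite /deflate normCK. Qed.

Lemma deflateP : semi_inner (deflate q a).
Proof.
split=> [z t x y|x y|x].
- by rewrite /deflate (si_linear qP) pivot_linear /=; ring.
- by rewrite /deflate rmorphB [in RHS]rmorphM /= conjCK -(si_herm qP) mulrC.
- rewrite deflate_diag subr_ge0 pivot_normM.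
  have [->|a0] := eqVneq (q a a) 0; first by rewrite invr0 mulr0 si_ge0.
  by rewrite ler_pdivrMr ?si_CauchySchwarz// lt_def a0 si_ge0.
Qed.

Lemma deflate_le x : deflate q a x x <= q x x.
Proof. by rewrite deflate_diag gerBl exprn_ge0. Qed.

Lemma deflate_self : deflate q a a a = 0.
Proof.
rewrite deflate_diag pivot_normM; have [a0|a0] := eqVneq (q a a) 0.
  by rewrite a0 invr0 mulr0 subr0.
by rewrite ger0_norm ?si_ge0// expr2 mulfK ?subrr.
Qed.

End Deflation.

Variables (q : V -> V -> C) (a : nat -> V).
Hypothesis qP : semi_inner q.

Lemma residualP k : semi_inner (residual q a k).
Proof. by elim: k => //= k IH; exact: deflateP. Qed.

Lemma residual_nincr m n x : (m <= n)%N ->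
  residual q a n x x <= residual q a m x x.
Proof.
move=> /subnK <-; elim: (n - m)%N => [|k IH]; first by rewrite add0n.
by rewrite addSn /=; apply: le_trans _ IH; apply: deflate_le; exact: residualP.
Qed.

(** Step [m] kills [a m]; afterwards the diagonal values can only decrease while staying
    nonnegative. *)
Lemma residual_eq0 m n : (m < n)%N -> residual q a n (a m) (a m) = 0.
Proof.
move=> mn; apply/le_anti/andP; split; last exact: (si_ge0 (residualP _)).
apply: le_trans (residual_nincr _ mn) _ => /=.
by rewrite (deflate_self _ (residualP m)).
Qed.

Lemma cholesky_linear k : scalar (cholesky q a k).
Proof. exact: (pivot_linear _ (residualP k)). Qed.

(** The sum telescopes: each squared coefficient is what one deflation removes from the diagonal. *)
Lemma sum_cholesky n x :
  \sum_(k < n) `|cholesky q a k x| ^+ 2 = q x x - residual q a n x x.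
Proof.
elim: n => [|n IH]; first by rewrite big_ord0 subrr.
by rewrite big_ord_recr IH /= deflate_diag; rewrite /cholesky; ring.
Qed.

(** Write [x] as [(x - a m) + a m]: the second term is null for the residual, and on the first the
    residual is at most [q]. The factor 2 comes from the parallelogram law. This turns density of
    [a] into convergence of the residuals to 0. *)
Lemma residual_le_dense m n x : (m < n)%N ->
  residual q a n x x <= 2 * q (x - a m) (x - a m).
Proof.
move=> mn; rewrite -{1 2}(subrK (a m) x).
apply: le_trans (si_normD_le (residualP n) _ _) _.
rewrite residual_eq0// addr0 ler_pM2l ?ltr0n//.
exact: (residual_nincr _ (leq0n n)).
Qed.

End Cholesky.

(** * Limits in the complex numbers *)

Section Tends.
Variables (C : numClosedFieldType) (T : Type).

(* Convergence in the numeric field itself: [R[i]] has no canonical topology. *)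
Definition tends (F : set_system T) (f : T -> C) (l : C) :=
  forall e, 0 < e -> \forall t \near F, `|l - f t| < e.

Lemma tendsP (F : set_system T) {FF : Filter F} (f : T -> C) l :
  tends F f l <-> f @ F --> l.
Proof. exact: iff_sym (cvgrPdist_lt _ _). Qed.

Context (F : set_system T) {FF : ProperFilter F}.

Lemma eq_tends f g l : f =1 g -> tends F f l -> tends F g l.
Proof. by move=> /funext ->. Qed.

Lemma tends_cst l : tends F (fun=> l) l.
Proof. by apply/tendsP; exact: cvg_cst. Qed.

Lemma tendsD f g l m :
  tends F f l -> tends F g m -> tends F (fun t => f t + g t) (l + m).
Proof. by move=> /tendsP fl /tendsP gm; apply/tendsP; exact: cvgD. Qed.

Lemma tendsM f g l m :
  tends F f l -> tends F g m -> tends F (fun t => f t * g t) (l * m).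
Proof. by move=> /tendsP fl /tendsP gm; apply/tendsP; exact: cvgM. Qed.

Lemma tendsMl a f l : tends F f l -> tends F (fun t => a * f t) (a * l).
Proof. by apply: tendsM; exact: tends_cst. Qed.

Lemma tendsN f l : tends F f l -> tends F (fun t => - f t) (- l).
Proof. by move=> /tendsP fl; apply/tendsP; exact: cvgN. Qed.

Lemma tends_conj f l : tends F f l -> tends F (fun t => (f t)^*) (l^*).
Proof.
move=> fl e /fl; apply: filterS => t.
by rewrite -rmorphB /= norm_conjC.
Qed.

Lemma tends_unique f l m : tends F f l -> tends F f m -> l = m.
Proof.
by move=> /tendsP fl /tendsP fm; apply: (cvg_unique _ fl fm).
Qed.

Lemma tends_sum n (f : nat -> T -> C) :
  (forall k, tends F (f k) 0) -> tends F (fun t => \sum_(k < n) f k t) 0.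
Proof.
move=> f0; elim: n => [|n IH].
  by apply: eq_tends (tends_cst 0) => t; rewrite big_ord0.
have := tendsD IH (f0 n); rewrite addr0; apply: eq_tends => t.
by rewrite big_ord_recr.
Qed.

End Tends.

(** * Monotone and Cauchy limits in [R[i]] *)

Section ComplexTends.
Variable R : realType.

Lemma Re_lt (x y : R[i]) : x < y -> complex.Re x < complex.Re y.
Proof. by rewrite ltcE => /andP[]. Qed.

Lemma Re_le (x y : R[i]) : x <= y -> complex.Re x <= complex.Re y.
Proof. by rewrite lecE => /andP[]. Qed.

Lemma gt0_RRe (e : R[i]) : 0 < e -> ((complex.Re e)%:C)%C = e.
Proof. by move=> e0; rewrite RRe_real// gtr0_real. Qed.

Lemma normc_le_ReIm (z : R[i]) :
  `|z| <= ((`|complex.Re z| + `|complex.Im z|)%:C)%C.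
Proof.
rewrite normc_def lecR -[leRHS]ger0_norm ?addr_ge0// -sqrtr_sqr.
rewrite ler_wsqrtr// sqrrD !real_normK ?num_real// addrAC lerDl.
by rewrite mulrn_wge0// mulr_ge0.
Qed.

Lemma ReIm_lt_normc (z : R[i]) (e : R[i]) : `|z| < e ->
  `|complex.Re z| < complex.Re e /\ `|complex.Im z| < complex.Re e.
Proof.
move=> /Re_lt; rewrite normc_def /= => ze; split; apply: le_lt_trans ze;
  rewrite -sqrtr_sqr ler_wsqrtr// ?lerDl ?lerDr ?sqr_ge0//.
Qed.

(** Comparable complex numbers have the same imaginary part, so that part is constant along [u] and
    only the real parts have to converge. The limit is also the least upper bound. *)
Lemma nondecreasing_tends (u : nat -> R[i]) M :
  {homo u : m n / (m <= n)%N >-> m <= n} -> (forall n, u n <= M) ->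
  exists l, [/\ tends \oo u l, forall n, u n <= l &
    forall M', (forall n, u n <= M') -> l <= M'].
Proof.
move=> u_nd uM; pose v n := complex.Re (u n).
have v_nd : {homo v : m n / (m <= n)%N >-> m <= n}.
  by move=> m n mn; exact/Re_le/u_nd.
have v_cvg : cvgn v.
  apply: nondecreasing_is_cvgn => //; exists (complex.Re M) => _ [n _ <-].
  exact/Re_le/uM.
pose l := (limn v +i* complex.Im (u 0%N))%C.
have uE n : u n = (v n +i* complex.Im (u 0%N))%C.
  have := u_nd _ _ (leq0n n); rewrite lecE => /andP[/eqP <- _].
  by rewrite /v; case: (u n).
exists l; split.
- move=> e e0; rewrite -(gt0_RRe e0).
  have e0' : 0 < complex.Re e by have := Re_lt e0.
  have /cvgrPdist_lt/(_ _ e0') := v_cvg.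
  apply: filterS => n vn; rewrite uE; apply: le_lt_trans (normc_le_ReIm _) _.
  by rewrite ltcR /= subrr normr0 addr0.
- by move=> n; rewrite uE lecE /= eqxx /= nondecreasing_cvgn_le.
- move=> M' uM'; rewrite lecE /=; apply/andP; split.
    by have := uM' 0%N; rewrite lecE => /andP[].
  apply: limr_le => //; apply: nearW => n; exact/Re_le/uM'.
Qed.

(** The Cauchy condition passes to the real and imaginary parts, which converge by completeness of
    [R]. *)
Lemma cauchy_tends (T : Type) (F : set_system T) {FF : ProperFilter F}
    (f : T -> R[i]) :
  (forall e : R[i], 0 < e ->
    exists c : R[i], \forall t \near F, `|c - f t| < e) ->
  exists l, tends F f l.
Proof.
move=> fC.
have re_cvg : cvg (complex.Re (f t) @[t --> F]).
  apply: cauchy_cvg; apply/cauchyP => e e0.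
  have [|c cf] := fC (e%:C)%C; first by rewrite ltcR.
  exists (complex.Re c); move: cf; apply: filterS => t /ReIm_lt_normc [+ _].
  by rewrite raddfB.
have im_cvg : cvg (complex.Im (f t) @[t --> F]).
  apply: cauchy_cvg; apply/cauchyP => e e0.
  have [|c cf] := fC (e%:C)%C; first by rewrite ltcR.
  exists (complex.Im c); move: cf; apply: filterS => t /ReIm_lt_normc [_].
  by rewrite raddfB.
exists (lim (complex.Re (f t) @[t --> F])
  +i* lim (complex.Im (f t) @[t --> F]))%C => e e0.
have e20 : 0 < complex.Re e / 2 by rewrite divr_gt0//; exact: (Re_lt e0).
have /cvgrPdist_lt/(_ _ e20) re_e := re_cvg.
have /cvgrPdist_lt/(_ _ e20) im_e := im_cvg.
near=> t; apply: le_lt_trans (normc_le_ReIm _) _; rewrite -(gt0_RRe e0) ltcR.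
rewrite !raddfB /= [ltRHS]splitr ltrD//; by near: t.
Unshelve. all: by end_near. Qed.

End ComplexTends.

(** * Square-summable sequences *)

Section SquareSummable.
Variables (C : numClosedFieldType) (V : lmodType C) (g : V -> V -> C).
Hypothesis gP : semi_inner g.

Notation T := (V * (nat -> C^o))%type.

(** The inner product of the direct sum, truncated to the first component and [n] scalar
    coordinates. Properties of the full inner product are limits of those of these semi-inner
    products. *)
Definition psum n (u v : T) : C :=
  g u.1 v.1 + \sum_(k < n) u.2 k * (v.2 k)^*.

Lemma psumP n : semi_inner (psum n).
Proof.
split=> [z t x y|x y|x].
- rewrite /psum (si_linear gP) mulrDr addrACA; congr (_ + _).
  rewrite mulr_sumr -big_split /=; apply: eq_bigr => k _.
  by rewrite mulrDl mulrA.
- rewrite /psum rmorphD /= -(si_herm gP); congr (_ + _).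
  rewrite rmorph_sum; apply: eq_bigr => k _.
  by rewrite rmorphM /= conjCK mulrC.
- rewrite addr_ge0 ?(si_ge0 gP)// sumr_ge0// => k _.
  by rewrite -normCK exprn_ge0.
Qed.

Lemma psum_diagE n u :
  psum n u u = g u.1 u.1 + \sum_(k < n) `|u.2 k : C| ^+ 2.
Proof. by congr (_ + _); apply: eq_bigr => k _; rewrite normCK. Qed.

Lemma psum_nd u : {homo (fun n => psum n u u) : m n / (m <= n)%N >-> m <= n}.
Proof.
move=> m n /subnK <-; elim: (n - m)%N => [|k IH]; first by rewrite add0n.
apply: le_trans IH _; rewrite addSn !psum_diagE lerD2l big_ord_recr /=.
by rewrite lerDl exprn_ge0.
Qed.

Lemma psum_fst n u : g u.1 u.1 <= psum n u u.
Proof. by rewrite psum_diagE lerDl sumr_ge0// => k _; rewrite exprn_ge0. Qed.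

Lemma psum_snd k u : `|u.2 k : C| ^+ 2 <= psum k.+1 u u.
Proof.
rewrite psum_diagE big_ord_recr /= addrA lerDr addr_ge0 ?(si_ge0 gP)//.
by rewrite sumr_ge0// => i _; rewrite exprn_ge0.
Qed.

(** Stated as a bound on the truncated norms, so that closure under linear combinations involves no
    limit. *)
Definition square_summable : {pred T} :=
  [pred u | `[< exists M, forall n, psum n u u <= M >]].

Lemma square_summableP u :
  reflect (exists M, forall n, psum n u u <= M) (u \in square_summable).
Proof. exact: asboolP. Qed.

Lemma square_summable_submod : submod_closed square_summable.
Proof.
split; first by apply/square_summableP; exists 0 => n; rewrite (si0l (psumP n)).
move=> a u v /square_summableP[M uM] /square_summableP[N vN].
apply/square_summableP; exists (2 * (`|a| ^+ 2 * M + N)) => n.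
apply: le_trans (si_normD_le (psumP n) _ _) _.
rewrite ler_pM2l ?ltr0n// lerD// (siZZ (psumP n)).
by rewrite ler_wpM2l ?exprn_ge0.
Qed.

HB.instance Definition _ :=
  GRing.isSubmodClosed.Build C T square_summable square_summable_submod.

(** Monotone completeness as a property of the abstract field; [nondecreasing_tends] supplies it for
    [R[i]]. *)
Definition order_complete := forall (u : nat -> C) M,
  {homo u : m n / (m <= n)%N >-> m <= n} -> (forall n, u n <= M) ->
  exists l, [/\ tends \oo u l, forall n, u n <= l &
    forall M', (forall n, u n <= M') -> l <= M'].

Hypothesis C_complete : order_complete.

(** The limit of the truncated inner products, with default value 0 where there is none; on
    square-summable arguments the limit exists. *)
Definition linner (u v : T) : C :=
  xget 0 [set l | tends \oo (fun n => psum n u v) l].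

Lemma linner_eq u v l : tends \oo (fun n => psum n u v) l -> linner u v = l.
Proof.
move=> ul; rewrite /linner; case: xgetP => [l' _ /= ul'|/(_ l)//].
exact: tends_unique ul' ul.
Qed.

Lemma linner_diag u : u \in square_summable ->
  [/\ tends \oo (fun n => psum n u u) (linner u u),
      forall n, psum n u u <= linner u u &
      forall M, (forall n, psum n u u <= M) -> linner u u <= M].
Proof.
move=> /square_summableP[M uM].
by have [l [ul]] := C_complete (psum_nd u) uM; rewrite (linner_eq ul).
Qed.

(** Diagonal truncations converge by monotonicity, and polarization writes the mixed ones as a
    combination of four diagonal ones. *)
Lemma linner_tends u v : u \in square_summable -> v \in square_summable ->
  tends \oo (fun n => psum n u v) (linner u v).
Proof.
move=> uS vS; suff [l ul] : exists l, tends \oo (fun n => psum n u v) l.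
  by rewrite (linner_eq ul).
pose d w := linner w w.
have dP w : w \in square_summable -> tends \oo (fun n => psum n w w) (d w).
  by case/linner_diag.
exists (4^-1 * (d (u + v) - d (u - v)
   + 'i * (d (u + 'i *: v) - d (u - 'i *: v)))).
have [d1 d2 d3 d4] : [/\ u + v \in square_summable, u - v \in square_summable,
    u + 'i *: v \in square_summable & u - 'i *: v \in square_summable].
  by split; rewrite ?rpredB ?rpredD ?rpredZ.
apply: eq_tends (tendsMl 4^-1 (tendsD (tendsD (dP _ d1) (tendsN (dP _ d2)))
  (tendsMl 'i (tendsD (dP _ d3) (tendsN (dP _ d4)))))).
by move=> n /=; rewrite -(si_polarization (psumP n)) mulKf// pnatr_eq0.
Qed.

Lemma linner_linear a u v w : u \in square_summable -> v \in square_summable ->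
  w \in square_summable -> linner (a *: u + v) w = a * linner u w + linner v w.
Proof.
move=> uS vS wS; apply: linner_eq.
apply: eq_tends (tendsD (tendsMl a (linner_tends uS wS)) (linner_tends vS wS)).
by move=> n; rewrite (si_linear (psumP n)).
Qed.

Lemma linner_herm u v : u \in square_summable -> v \in square_summable ->
  linner u v = (linner v u)^*.
Proof.
move=> uS vS; apply: linner_eq.
apply: eq_tends (tends_conj (linner_tends vS uS)) => n.
by rewrite -(si_herm (psumP n)).
Qed.

End SquareSummable.

(** * The Hilbert sum of a Hilbert space and l^2 *)

(* Retyping [inner] over [R[i]] as a numClosedFieldType: the coercions inside the
   raw form make HB fail on [square_summable (@inner R K)]. *)
Definition hinner (R : realType) (K : hilbertType R) (x y : K) : R[i] :=
  inner x y.

Lemma hinner_semi_inner (R : realType) (K : hilbertType R) :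
  @semi_inner R[i] K (@hinner R K).
Proof.
split=> [z a x y|x y|x].
- by rewrite /hinner linearPl.
- by rewrite /hinner hermC expr0 mul1r.
- by rewrite /hinner inner_normE exprn_ge0.
Qed.

Definition hsum_pred (R : realType) (K : hilbertType R) :
  {pred K * (nat -> R[i]^o)} := @square_summable R[i] K (@hinner R K).

Lemma hsum_submod (R : realType) (K : hilbertType R) :
  submod_closed (@hsum_pred R K).
Proof. exact/square_summable_submod/hinner_semi_inner. Qed.

HB.instance Definition _ (R : realType) (K : hilbertType R) :=
  GRing.isSubmodClosed.Build R[i] (K * (nat -> R[i]^o))%type (@hsum_pred R K)
  (@hsum_submod R K).

Record hsum (R : realType) (K : hilbertType R) := Hsum {
  hsum_val : K * (nat -> R[i]^o);
  hsum_valP : hsum_val \in @hsum_pred R K }.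

Section HilbertSum.
Variables (R : realType) (K : hilbertType R).

HB.instance Definition _ := [isSub for @hsum_val R K].
HB.instance Definition _ := [Choice of hsum K by <:].
HB.instance Definition _ := [SubChoice_isSubLmodule of hsum K by <:].

End HilbertSum.

(** * Inner product and norm of the Hilbert sum *)

Section HilbertSumInner.
Variables (R : realType) (K : hilbertType R).
Implicit Types u v : hsum K.

Let KP := @hinner_semi_inner R K.

Definition hsum_part n u v : R[i] :=
  @psum R[i] K (@hinner R K) n (val u) (val v).

Definition hsum_inner u v : R[i] :=
  @linner R[i] K (@hinner R K) (val u) (val v).

Lemma hsum_partP n : @semi_inner R[i] (hsum K) (hsum_part n).
Proof.
have pP := psumP KP n.
split=> [w a u v|u v|u].
- by rewrite /hsum_part linearP (si_linear pP).
- exact: (si_herm pP).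
- exact: (si_ge0 pP).
Qed.

Lemma complex_order_complete : order_complete R[i].
Proof. exact: nondecreasing_tends. Qed.

Lemma hsum_inner_diag u : [/\
  tends \oo (fun n => hsum_part n u u) (hsum_inner u u),
  forall n, hsum_part n u u <= hsum_inner u u &
  forall M, (forall n, hsum_part n u u <= M) -> hsum_inner u u <= M].
Proof. exact: (linner_diag complex_order_complete (hsum_valP u)). Qed.

Lemma hsum_part_le n u : hsum_part n u u <= hsum_inner u u.
Proof. by case: (hsum_inner_diag u). Qed.

Lemma hsum_inner_le u M :
  (forall n, hsum_part n u u <= M) -> hsum_inner u u <= M.
Proof. by case: (hsum_inner_diag u) => _ _; exact. Qed.

Lemma hsum_innerP : @semi_inner R[i] (hsum K) hsum_inner.
Proof.
split=> [w a u v|u v|u].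
- rewrite /hsum_inner linearP.
  exact: (linner_linear KP complex_order_complete a (hsum_valP u) (hsum_valP v)
    (hsum_valP w)).
- exact: (linner_herm KP complex_order_complete (hsum_valP u) (hsum_valP v)).
- exact: le_trans (si_ge0 (hsum_partP 0) u) (hsum_part_le 0 u).
Qed.

Lemma hsum_fst_le u : `|(val u).1| ^+ 2 <= hsum_inner u u.
Proof.
apply: le_trans (hsum_part_le 0 u).
by have := psum_fst (@hinner R K) 0 (val u); rewrite /hinner inner_normE.
Qed.

Lemma hsum_snd_le k u : `|(val u).2 k : R[i]| ^+ 2 <= hsum_inner u u.
Proof. exact: le_trans (psum_snd KP k (val u)) (hsum_part_le k.+1 u). Qed.

(** Every coordinate is bounded by the norm, hence vanishes with it. *)
Lemma hsum_inner_eq0 u : hsum_inner u u = 0 -> u = 0.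
Proof.
move=> u0; apply: val_inj => /=.
have := hsum_fst_le u; have := fun k => hsum_snd_le k u.
rewrite u0 /=; case: (hsum_val u) => x f /= f0 x0.
have n0 (V : normedZmodType R[i]) (y : V) : `|y| ^+ 2 <= 0 -> y = 0.
  move=> y0; apply/eqP; rewrite -normr_eq0 -sqrf_eq0; apply/eqP/le_anti.
  by rewrite y0 exprn_ge0.
have -> : x = 0 by exact: n0.
by have -> : f = 0 by apply/funext => k; exact: (n0 R[i]).
Qed.

Definition hsum_norm u : R[i] := sqrtC (hsum_inner u u).

Lemma hsum_normD u v : hsum_norm (u + v) <= hsum_norm u + hsum_norm v.
Proof. exact: (si_triangle hsum_innerP). Qed.

Lemma hsum_normZ (a : R[i]) u : hsum_norm (a *: u) = `|a| * hsum_norm u.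
Proof.
rewrite /hsum_norm (siZZ hsum_innerP) sqrtCM ?nnegrE ?exprn_ge0//.
  by rewrite sqrCK.
exact: si_ge0 hsum_innerP u.
Qed.

Lemma hsum_norm_eq0 u : hsum_norm u = 0 -> u = 0.
Proof. by move=> /eqP; rewrite sqrtC_eq0 => /eqP/hsum_inner_eq0. Qed.

HB.instance Definition _ := Lmodule_isNormed.Build R[i] (hsum K)
  hsum_normD hsum_normZ hsum_norm_eq0.

Lemma hsum_normE u : hsum_inner u u = `|u| ^+ 2.
Proof. by rewrite sqrtCK. Qed.

End HilbertSumInner.

(** * Completeness of the Hilbert sum and its Hilbert structure *)

Section HilbertSumComplete.
Variables (R : realType) (K : hilbertType R).
Implicit Types u v : hsum K.

Let KP := @hinner_semi_inner R K.

Lemma hsum_fst_norm u : `|(val u).1| <= `|u|.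
Proof.
rewrite -(@ler_pXn2r _ 2) ?nnegrE//.
by have := hsum_fst_le u; rewrite hsum_normE.
Qed.

Lemma hsum_snd_norm k u : `|(val u).2 k : R[i]| <= `|u|.
Proof.
rewrite -(@ler_pXn2r _ 2) ?nnegrE//.
by have := hsum_snd_le k u; rewrite hsum_normE.
Qed.

Lemma hsum_part_norm n u : hsum_part n u u <= `|u| ^+ 2.
Proof. by rewrite -hsum_normE hsum_part_le. Qed.

Lemma hsum_norm_le u (e : R[i]) : 0 <= e ->
  (forall n, hsum_part n u u <= e ^+ 2) -> `|u| <= e.
Proof.
move=> e0 ue; rewrite -(@ler_pXn2r _ 2) ?nnegrE// -hsum_normE.
exact: hsum_inner_le.
Qed.

(** The limit is built coordinate by coordinate. Truncated distances to it are bounded uniformly in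
    the truncation, which gives both its square-summability and convergence in norm. *)
Lemma hsum_cauchy_cvg (F : set_system (hsum K)) : ProperFilter F ->
  cauchy F -> cvg F.
Proof.
move=> FF FC.
have {}FC (e : R[i]) : 0 < e -> exists c, \forall u \near F, `|c - u| < e.
  move=> e0; have /cauchyP/(_ _ e0)[c cF] := FC; exists c.
  by move: cF; rewrite -ball_normE.
have cvg1 : cvg ((val u).1 @[u --> F]).
  apply: cauchy_cvg; apply/cauchyP => e /FC[c cF]; exists (val c).1.
  move: cF; rewrite -ball_normE; apply: filterS => u /=; apply: le_lt_trans.
  by have := hsum_fst_norm (c - u); rewrite raddfB.
have /choice[f cvg2] k : exists l, tends F (fun u => (val u).2 k : R[i]) l.
  apply: cauchy_tends => e /FC[c cF]; exists ((val c).2 k).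
  move: cF; apply: filterS => u; apply: le_lt_trans.
  by have := hsum_snd_norm k (c - u); rewrite raddfB.
pose l : K * (nat -> R[i]^o) := (lim ((val u).1 @[u --> F]), f).
pose d n (w : K * (nat -> R[i]^o)) : R[i] := @psum R[i] K (@hinner R K) n w w.
(* For fixed [n] only finitely many coordinates enter, so coordinatewise convergence suffices. *)
have tends0 n : tends F (fun u => d n (val u - l)) 0.
  have sq0 (V : normedZmodType R[i]) (w : V) (h : hsum K -> V) :
      (forall e : R[i], 0 < e -> \forall u \near F, `|w - h u| < e) ->
      tends F (fun u => `|h u - w| ^+ 2) 0.
    move=> hw.
    have hw0 : tends F (fun u => `|h u - w|) 0.
      move=> e /hw; apply: filterS => u.
      by rewrite sub0r normrN normr_id distrC.
    have := @tendsM _ _ F FF _ _ _ _ hw0 hw0; rewrite mulr0; exact: eq_tends.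
  have t2 : tends F (fun u => \sum_(k < n) `|(val u).2 k - f k : R[i]| ^+ 2) 0.
    apply: (@tends_sum _ _ _ _ n (fun k u => `|(val u).2 k - f k : R[i]| ^+ 2)).
    move=> k; apply: (sq0 R[i]); exact: cvg2.
  have t1 : tends F (fun u => `|(val u).1 - l.1| ^+ 2) 0.
    by apply: sq0; apply/cvgrPdist_lt; exact: cvg1.
  have := @tendsD _ _ F FF _ _ _ _ t1 t2; rewrite addr0; apply: eq_tends => u.
  by rewrite /d psum_diagE /hinner inner_normE.
have dD n w w' : d n (w + w') <= 2 * (d n w + d n w').
  exact: (si_normD_le (psumP KP n)).
have dN n w w' : d n (w - w') = d n (w' - w).
  exact: (si_normBC (psumP KP n)).
(* The intermediate point [u] depends on [n], but the bound [2 * (e ^+ 2 + e ^+ 2)] does not. *)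
have cl_le (e : R[i]) c : 0 < e -> (\forall u \near F, `|c - u| < e) ->
    forall n, d n (val c - l) <= 4 * e ^+ 2.
  move=> e0 cF n; have e20 : 0 < e ^+ 2 by rewrite exprn_gt0.
  near F => u.
  have cu : d n (val c - val u) <= e ^+ 2.
    have := hsum_part_norm n (c - u); rewrite /hsum_part raddfB.
    move=> /le_trans; apply; rewrite ler_pXn2r ?nnegrE ?(ltW e0)//.
    by apply: ltW; near: u.
  have ul : d n (val u - l) <= e ^+ 2.
    apply: le_trans (real_ler_norm _) _.
      exact/ger0_real/(si_ge0 (psumP KP n)).
    apply: ltW; rewrite -normrN -sub0r; near: u; exact: tends0.
  rewrite -(subrKA (val u)); apply: le_trans (dD _ _ _) _.
  have -> : 4 * e ^+ 2 = 2 * (e ^+ 2 + e ^+ 2) by ring.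
  by rewrite ler_pM2l ?ltr0n// lerD.
have lP : l \in @hsum_pred R K.
  have [c cF] := FC 1 ltr01.
  (* The candidate is [c - (c - l)], a difference of two square-summable elements. *)
  rewrite -(subKr (val c) l) rpredB ?hsum_valP//.
  by apply/square_summableP; exists (4 * 1 ^+ 2); exact: cl_le cF.
apply/cvg_ex; exists (Hsum lP); apply/cvgrPdist_le => e e0.
(* With radius [e / 4] the two estimates add up to [10 / 16 * e ^+ 2], below [e ^+ 2]. *)
have e40 : 0 < e / 4 by rewrite divr_gt0.
have [c cF] := FC _ e40; move: (cF); apply: filterS => u cu.
apply: hsum_norm_le (ltW e0) _ => n.
rewrite /hsum_part raddfB -/(d n _) /= -(subrKA (val c)).
apply: le_trans (dD _ _ _) _; rewrite (dN _ l).
have cu2 : d n (val c - val u) <= (e / 4) ^+ 2.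
  have := hsum_part_norm n (c - u); rewrite /hsum_part raddfB.
  by move=> /le_trans; apply; rewrite ler_pXn2r ?nnegrE ?(ltW e40) ?(ltW cu).
apply: le_trans (_ : 2 * (4 * (e / 4) ^+ 2 + (e / 4) ^+ 2) <= _).
  by rewrite ler_pM2l ?ltr0n// lerD// cl_le.
have -> : 2 * (4 * (e / 4) ^+ 2 + (e / 4) ^+ 2) = 10 / 16 * e ^+ 2 by field.
by rewrite ler_piMl ?exprn_ge0 ?(ltW e0)// ler_pdivrMr ?ltr0n// mul1r ler_nat.
Unshelve. all: by end_near. Qed.

HB.instance Definition _ := Uniform_isComplete.Build (hsum K) hsum_cauchy_cvg.

Lemma hsum_bilinear : bilinear_for
  (GRing.Scale.Law.clone _ _ ( *%R ) _)
  (GRing.Scale.Law.clone _ _ (@Num.conj R[i] \; *%R) _)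
  (@hsum_inner R K : hsum K -> hsum K -> R[i]).
Proof.
split=> w a u v; first exact: (si_linear (hsum_innerP K)).
exact: (si_linearr (hsum_innerP K)).
Qed.

HB.instance Definition _ := bilinear_isBilinear.Build R[i] (hsum K) (hsum K)
  R[i] _ _ (@hsum_inner R K) hsum_bilinear.

Lemma hsum_hermitian u v :
  hsum_inner u v = (-1) ^+ false * (hsum_inner v u)^*.
Proof. by rewrite expr0 mul1r; exact: (si_herm (hsum_innerP K)). Qed.

HB.instance Definition _ := isHermitianSesquilinear.Build R[i] (hsum K)
  false (@Num.conj R[i]) (@hsum_inner R K) hsum_hermitian.

Lemma hsum_inner_gt0 u : u != 0 -> 0 < hsum_inner u u.
Proof. by move=> u0; rewrite hsum_normE exprn_gt0 ?normr_gt0. Qed.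

HB.instance Definition _ := isDotProduct.Build R[i] (hsum K)
  (@hsum_inner R K) hsum_inner_gt0.

HB.instance Definition _ := CompleteNormedModule_isHilbert.Build R (hsum K)
  (@hsum_normE R K).

End HilbertSumComplete.

(** * Dense sequences and separability of the Hilbert sum *)

Lemma dense_norm (K : numFieldType) (V : normedModType K) (A : set V) :
  dense A <-> forall x e, 0 < e -> exists2 a, A a & `|x - a| < e.
Proof.
split=> [Ad x e e0|Ad O [x Ox] Oo].
  have [|a [xa Aa]] := Ad (ball x e) _ (ball_open _ _).
    by exists x; exact: ballxx.
  by exists a => //; move: xa; rewrite -ball_normE.
have /nbhs_ballP[e /= e0 eO] : nbhs x O by exact: open_nbhs_nbhs.
have [a Aa xa] := Ad x e e0; exists a; split=> //.
by apply: eO; rewrite -ball_normE.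
Qed.

Lemma dense_sequence (K : numFieldType) (V : normedModType K) :
  separable V -> exists a : nat -> V,
    forall x e, 0 < e -> exists n, `|x - a n| < e.
Proof.
(* A countable set is empty or the range of a sequence; approximating 0 excludes the empty set. *)
move=> [A /pfcard_geP[A0 /dense_norm/(_ 0 1 ltr01)[a]|[f] /dense_norm Ad]].
  by rewrite A0.
exists f => x e /(Ad x)[_ /(@surj _ _ _ _ f) [n _ <-] xa]; by exists n.
Qed.

Section HilbertSumSeparable.
Variables (R : realType) (K : hilbertType R).

Definition qc (q : rat * rat) : R[i] := (ratr q.1 +i* ratr q.2)%C.

Lemma qc_dense (z e : R[i]) : 0 < e -> exists q, `|z - qc q| < e.
Proof.
move=> e0; have e20 : 0 < complex.Re e / 2.
  by rewrite divr_gt0//; exact: (Re_lt e0).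
have ratd (x : R) : exists q, `|x - ratr q| < complex.Re e / 2.
  have [|y [xy [q _ qy]]] :=
      @dense_rat R (ball x (complex.Re e / 2)) _ (ball_open _ _).
    by exists x; exact: ballxx.
  by exists q; rewrite qy; move: xy; rewrite -ball_normE.
have [q1 q1P] := ratd (complex.Re z); have [q2 q2P] := ratd (complex.Im z).
exists (q1, q2); apply: le_lt_trans (normc_le_ReIm _) _.
by rewrite -(gt0_RRe e0) ltcR !raddfB /= [ltRHS]splitr ltrD.
Qed.

Lemma qc0 : qc (0, 0) = 0.
Proof. by rewrite /qc !rmorph0. Qed.

(** Finite lists of Gaussian rationals, padded with zeros, form a countable set of sequences that
    will be dense in l^2. *)
Definition qsum (p : K * seq (rat * rat)) : K * (nat -> R[i]^o) :=
  (p.1, fun k => qc (nth (0, 0) p.2 k)).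

Lemma psum_stable N n (w : K * (nat -> R[i]^o)) :
  (forall k, (N <= k)%N -> w.2 k = 0) -> (N <= n)%N ->
  @psum R[i] K (@hinner R K) n w w = @psum R[i] K (@hinner R K) N w w.
Proof.
move=> w0 /subnK <-; elim: (n - N)%N => [|m IH]; first by rewrite add0n.
rewrite addSn -IH !psum_diagE big_ord_recr /= w0 ?leq_addl//.
by rewrite normr0 expr0n !addr0.
Qed.

Lemma qsumP p : qsum p \in @hsum_pred R K.
Proof.
apply/square_summableP.
exists (@psum R[i] K (@hinner R K) (size p.2) (qsum p) (qsum p)).
move=> n; have [np|np] := leqP n (size p.2); first exact: psum_nd.
rewrite (psum_stable _ (ltnW np))// => k pk /=.
by rewrite nth_default// qc0.
Qed.

Lemma hsum_separable : separable K -> separable (hsum K).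
Proof.
move=> [A Ac /dense_norm Ad].
exists ((fun p => Hsum (qsumP p)) @` (A `*` [set: seq (rat * rat)])).
  apply: (sub_countable (card_image_le _ _)).
  by apply: countableX.
apply/dense_norm => u e e0.
(* The squared error is split into a tail and a head of at most [e ^+ 2 / 8] each, giving
   [(e / 2) ^+ 2] in total; halving [e] restores the strict inequality. *)
have e80 : 0 < e ^+ 2 / 8 by rewrite divr_gt0 ?exprn_gt0.
have [uN _ _] := hsum_inner_diag u.
have [N _ NP] := uN _ e80.
have {NP} : hsum_inner u u - hsum_part N u u < e ^+ 2 / 8.
  apply: le_lt_trans (NP N (leqnn N)); apply: real_ler_norm.
  by rewrite ger0_real// subr_ge0 hsum_part_le.
move=> uNe.
(* The head has [N.+1] components, the one in [K] and [N] scalars, each approximated within [d]. *)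
pose d := e / (4 * N.+1%:R).
have d0 : 0 < d by rewrite divr_gt0 ?mulr_gt0 ?ltr0n.
have [a Aa ua] := Ad (val u).1 d d0.
have /choice[q qP] k := qc_dense ((val u).2 k : R[i]) d0.
pose w := Hsum (qsumP (a, mkseq q N)).
exists w; first by exists (a, mkseq q N).
have e1 : e / 2 < e by rewrite ltr_pdivrMr// mulr_natr mulr2n ltrDl.
apply: le_lt_trans e1; apply: hsum_norm_le => [|n].
  by rewrite divr_ge0// ltW.
(* By monotonicity only truncations at [N + n] need a bound. *)
apply: le_trans (psum_nd (@hinner R K) (val (u - w)) (leq_addl N n)) _.
have valB : val (u - w) = val u - val w by rewrite raddfB.
(* Since [w] vanishes from index [N] on, the tail of [u - w] is that of [u]. *)
have -> : @psum R[i] K (@hinner R K) (N + n) (val (u - w)) (val (u - w)) =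
    hsum_part N (u - w) (u - w) + (hsum_part (N + n) u u - hsum_part N u u).
  have addcK (x y z : R[i]) : x + (y + z) - (x + y) = z by ring.
  rewrite /hsum_part valB !psum_diagE !big_split_ord /=.
  rewrite addcK addrA; congr (_ + _).
  apply: eq_bigr => k _; congr (`| _ | ^+ 2).
  have w0 : (val w).2 (rshift N k) = 0.
    by rewrite /= nth_default ?size_mkseq ?leq_addr// qc0.
  transitivity ((val u).2 (rshift N k) - (val w).2 (rshift N k)) => //.
  by rewrite w0 subr0.
have Ne : hsum_part (N + n) u u - hsum_part N u u <= e ^+ 2 / 8.
  by apply: le_trans (ltW uNe); rewrite lerD2r hsum_part_le.
have de : hsum_part N (u - w) (u - w) <= N.+1%:R * d ^+ 2.
  rewrite /hsum_part valB psum_diagE /= /hinner inner_normE.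
  rewrite mulr_natl mulrS lerD//.
    by rewrite ler_pXn2r ?nnegrE ?(ltW d0)// ltW.
  rewrite -[X in _ *+ X]card_ord -sumr_const; apply: ler_sum => k _.
  have wk : (val w).2 k = qc (q k) by rewrite /= nth_mkseq.
  rewrite -[X in `|X|]/((val u).2 k - (val w).2 k) wk.
  by rewrite ler_pXn2r ?nnegrE ?(ltW d0)// ltW.
apply: le_trans (lerD de Ne) _.
have -> : N.+1%:R * d ^+ 2 = e ^+ 2 / (16 * N.+1%:R).
  have : N.+1%:R != 0 :> R[i] by rewrite pnatr_eq0.
  by rewrite /d; move: (N.+1%:R : R[i]) => m m0; field.
have -> : (e / 2) ^+ 2 = e ^+ 2 / 8 + e ^+ 2 / 8 by field.
rewrite lerD2r ler_pM2l ?exprn_gt0// lef_pV2 ?posrE ?mulr_gt0 ?ltr0n//.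
by rewrite -natrM ler_nat; lia.
Qed.

End HilbertSumSeparable.

(** * The parent space *)

Section Dilation.
Variables (R : realType) (G K : hilbertType R) (J : {linear G -> K}).
Hypothesis J_contr : contractive_op J.

Let KP := @hinner_semi_inner R K.
Let GP := @hinner_semi_inner R G.

Definition defect (x y : G) : R[i] := hinner x y - hinner (J x) (J y).

Lemma defect_diag x : defect x x = `|x| ^+ 2 - `|J x| ^+ 2.
Proof. by rewrite /defect /hinner !inner_normE. Qed.

(** This is the form of [1 - J^* J]; its positivity is where contractivity enters. *)
Lemma defectP : @semi_inner R[i] G defect.
Proof.
split=> [z a x y|x y|x].
- by rewrite /defect linearP (si_linear GP) (si_linear KP) /=; ring.
- by rewrite /defect rmorphB /= -(si_herm GP) -(si_herm KP).
- rewrite defect_diag subr_ge0 ler_pXn2r ?nnegrE//.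
  by move/contractive_opP: J_contr.
Qed.

Lemma dilation : separable G -> exists iota : {linear G -> hsum K},
  is_isometry iota /\ forall x, (val (iota x)).1 = J x.
Proof.
move=> /dense_sequence[a a_dense].
pose D x : K * (nat -> R[i]^o) := (J x, fun k => cholesky defect a k x).
(* The first component contributes [|J x|^2], which cancels against the defect, so the residual is
   all that separates the truncation from isometry. *)
have psumD n x : @psum R[i] K (@hinner R K) n (D x) (D x) =
    `|x| ^+ 2 - residual defect a n x x.
  rewrite psum_diagE /= sum_cholesky defect_diag /hinner inner_normE.
  by ring.
have res_ge0 n x : 0 <= residual defect a n x x.
  exact: (si_ge0 (residualP _ defectP n)).
have DP x : D x \in @hsum_pred R K.
  apply/square_summableP; exists (`|x| ^+ 2) => n.
  by rewrite psumD gerBl.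
have D_linear : linear (fun x => Hsum (DP x)).
  move=> t x y; apply: val_inj; rewrite linearP /= /D linearP.
  congr pair; apply/funext => k.
  exact: cholesky_linear defectP k t x y.
pose iota : {linear G -> hsum K} := HB.pack (fun x => Hsum (DP x))
  (GRing.isLinear.Build R[i] G (hsum K) _ _ D_linear).
exists iota; split=> // x.
have : hsum_inner (iota x) (iota x) = `|x| ^+ 2.
  apply: linner_eq => e e0.
  (* The residual is at most [2 * |x - a m|^2], which this radius makes smaller than [e]. *)
  have e20 : 0 < sqrtC (e / 2) by rewrite sqrtC_gt0 divr_gt0.
  have [m xm] := a_dense x _ e20.
  (* The vector [a m] is eliminated only after [m.+1] deflations. *)
  exists m.+1 => // n /= mn; rewrite psumD subKr ger0_norm//.
  apply: le_lt_trans (residual_le_dense _ defectP x mn) _.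
  apply: le_lt_trans (_ : 2 * `|x - a m| ^+ 2 < e).
    by rewrite ler_pM2l ?ltr0n// defect_diag gerBl exprn_ge0.
  rewrite mulrC -ltr_pdivlMr ?ltr0n// -[ltRHS]sqrtCK.
  by rewrite ltr_pXn2r ?nnegrE ?(ltW e20).
by rewrite hsum_normE => /eqP; rewrite eqrXn2// => /eqP.
Qed.

End Dilation.

Lemma hsum_inj (R : realType) (K : hilbertType R) :
  exists iota : {linear K -> hsum K},
  forall x, val (iota x) = (x, 0).
Proof.
have xP (x : K) : ((x, 0) : K * (nat -> R[i]^o)) \in @hsum_pred R K.
  apply/square_summableP; exists (`|x| ^+ 2) => n.
  rewrite psum_diagE /hinner inner_normE big1 ?addr0// => k _.
  by rewrite normr0 expr0n.
have inj_linear : linear (fun x => Hsum (xP x)).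
  move=> t x y; apply: val_inj; rewrite linearP /=.
  congr pair; apply/funext => k /=.
  by transitivity (t * 0 + 0 : R[i]) => //; rewrite mulr0 addr0.
pose iota : {linear K -> hsum K} := HB.pack (fun x => Hsum (xP x))
  (GRing.isLinear.Build R[i] K (hsum K) _ _ inj_linear).
by exists iota.
Qed.
Theorem theorem3p1 (R : realType) (H_ : option nat -> hilbertType R)
    (H_sep : forall n : option nat, separable (H_ n))
    (J : forall n : nat, {linear H_ (Some n) -> H_ None})
    (J_contr : forall n : nat, contractive_op (J n)) :
  exists (H : hilbertType R) (iota : forall n : option nat, {linear H_ n -> H})
    (iota_oo_adj : {linear H -> H_ None}),
    [/\ separable H,
        forall n : option nat, is_isometry (iota n),
        is_adjoint (iota None) iota_oo_adj
      & forall n : nat, J n =1 iota_oo_adj \o iota (Some n)].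
Proof.
pose K := H_ None; have [iota0 iota0P] := hsum_inj K.
(* All truncations equal the inner product of the first components; this is the adjoint relation for
   the first projection. *)
have iota0_inner x u : hsum_inner (iota0 x) u = hinner x (val u).1.
  apply: linner_eq; apply: eq_tends (tends_cst _) => n.
  rewrite iota0P /psum /= big1 ?addr0// => k _; exact: mul0r.
(* Both kinds of index are put in one dependent statement, so that a single choice yields the whole
   family. *)
have iotaE n : exists iota : {linear H_ n -> hsum K}, is_isometry iota /\
    match n return ({linear H_ n -> hsum K} -> Prop) with
    | None => fun iota => forall x u, hsum_inner (iota x) u = hinner x (val u).1
    | Some n => fun iota => forall x, (val (iota x)).1 = J n x
    end iota.
  case: n => [n|]; first exact: dilation (J_contr n) (H_sep _).
  exists iota0; split=> // x.
  have : `|iota0 x| ^+ 2 = `|x| ^+ 2.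
    by rewrite -hsum_normE iota0_inner iota0P /hinner inner_normE.
  by move/eqP; rewrite eqrXn2// => /eqP.
pose iota n := sval (cid (iotaE n)).
have iotaP n := svalP (cid (iotaE n)).
(* With the first projection as adjoint, the factorization says that the first component of
   [iota (Some n) x] is [J n x]. *)
exists (hsum K), iota, (fst \o val).
split.
- exact: (hsum_separable (H_sep None)).
- by move=> n; case: (iotaP n).
- by move=> x u; case: (iotaP None) => _ /(_ x u).
- by move=> n x; case: (iotaP (Some n)) => _ /(_ x).
Qed.
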